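(* Let $0<s_0<\frac{1}{128}$ be fixed. For any Boolean function $f:C_n\to\{0,1\}$ and any $n\geq 1$, the following holds: $$\mathrm{Var}_{\mu^n}(f)\leq C\left(\sum_{i=1}^n\|D_if\|_{1+e^{-2s_0}}^2+\sum_{\substack{i,j=1\\ i\neq j}}^n\frac{\|D_{ij}f\|_2^2}{\left[1+\log\left(\frac{\|D_{ij}f\|_2}{\|D_{ij}f\|_1}\right)\right]^2}\right),$$ where $C>0$ is a numerical constant (in particular, $s_0$ and $C$ are independent of $f$ and $n$).
   Context: $C_n=\{-1,1\}^n$ is the discrete cube, equipped with the uniform probability measure $\mu^n$, and $\|\cdot\|_p$ denotes the norm of $L^p(\mu^n)$. The variance is $\mathrm{Var}_{\mu^n}(f)=\int_{C_n}f^2\,d\mu^n-\left(\int_{C_n}f\,d\mu^n\right)^2$. For $x\in C_n$ and $i\in\{1,\ldots,n\}$, $\tau_ix=(x_1,\ldots,-x_i,\ldots,x_n)$ is the point $x$ with its $i$-th coordinate flipped. The discrete derivative along the $i$-th coordinate of a function $f:C_n\to\mathbb{R}$ is $D_if(x)=f(\tau_ix)-f(x)$, and $D_{ij}=D_i\circ D_j$ for $i,j\in\{1,\ldots,n\}$. A term of the second sum with $D_{ij}f=0$ is interpreted as $0$. *)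

(* Defs.v *)
From mathcomp Require Import all_boot all_order all_algebra.
From mathcomp Require Import reals sequences exp.

Set Implicit Arguments.
Unset Strict Implicit.
Unset Printing Implicit Defensive.

Import Order.TTheory GRing.Theory Num.Theory.

Local Open Scope ring_scope.

(* A point of {-1,1}^n is recorded by its signs: the boolean [b] stands for
   the coordinate (-1)^b, so changing the sign of a coordinate is [negb]. *)
Definition cube (n : nat) : finType := {ffun 'I_n -> bool}.

Definition flip (n : nat) (i : 'I_n) (x : cube n) : cube n :=
  [ffun j => if j == i then ~~ x j else x j].

Section DiscreteCube.
Variables (R : realType) (n : nat).
Implicit Types (f : cube n -> R) (p : R).

(* Integral with respect to the uniform probability measure. *)
Definition cube_mean f : R := (\sum_(x : cube n) f x) / #|cube n|%:R.

Definition cube_var f : R := cube_mean (fun x => f x ^+ 2) - cube_mean f ^+ 2.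

(* For finite p > 0. In particular [lpnorm p f = 0] when f vanishes identically,
   so a quotient with numerator [lpnorm 2 f ^+ 2] is then 0 as well. *)
Definition lpnorm p f : R := cube_mean (fun x => `|f x| `^ p) `^ p^-1.

Definition discr_deriv (i : 'I_n) f : cube n -> R := fun x => f (flip i x) - f x.

Definition discr_deriv2 (i j : 'I_n) f : cube n -> R := discr_deriv i (discr_deriv j f).

End DiscreteCube.

(* Main.v *)
Require Import Defs.
From mathcomp Require Import all_boot all_order all_algebra.
From mathcomp Require Import reals sequences exp.
From mathcomp Require Import ring lra.

Import Order.TTheory GRing.Theory Num.Theory.

Local Open Scope ring_scope.

(** The inequality holds for every real-valued function on the cube, with the
    L1 norms of the first derivatives and with the constant 243; the stated
    form follows because a derivative of a Boolean function takes its absolute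
    values in {0, 1}, so that its L1 norm is at most its Lp norm for p >= 1.

    Expand [f] in the characters [chi S]. By Parseval, the variance is the sum
    of the squares of the coefficients over the nonempty sets [S].

    Level one: up to sign, the coefficient at the singleton of [i] is half
    that of [discr_deriv i f], hence at most half the L1 norm of that
    derivative ([level1_le]).

    Levels two and more: the coefficient of [discr_deriv2 i j f] at [S] is four
    times that of [f] if [S] contains [i] and [j], and vanishes otherwise. A set
    [S] of size k >= 2 contains k(k-1) ordered pairs of distinct elements, and
    16k(k-1) >= (k+1)^2, so these levels weigh at most the sum over the pairs
    of the weighted masses of [g = discr_deriv2 i j f], in which the square of
    the coefficient at [S] is divided by [(#|S| + 1)^2] ([high_levels_le]).

    It remains to bound one weighted mass by a multiple of
    [|g|_2^2 / (1 + ln r)^2], where [r = |g|_2 / |g|_1] ([talagrand_spectral]).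
    Above a level [m] the weight is at most [(m + 1)^-2]. Up to level [m],
    hypercontractivity in the form of a fourth moment bound ([bonami]) shows
    that the mass is at most [3^m |g|_2 |g|_1 = 3^m |g|_2^2 / r]
    ([low_degree_mass]). A level [m] of order [ln r] makes both parts small
    enough. *)

(** * Means over the cube *)

Section Mean.
Context {R : realType} {n : nat}.
Implicit Types (f g : cube n -> R).

Lemma card_cube_gt0 : 0 < #|cube n|%:R :> R.
Proof. by rewrite ltr0n; apply/card_gt0P; exists [ffun=> false]. Qed.

Lemma eq_mean f g : f =1 g -> cube_mean f = cube_mean g.
Proof. by move=> efg; rewrite /cube_mean (eq_bigr _ (fun x _ => efg x)). Qed.

Lemma meanD f g : cube_mean (fun x => f x + g x) = cube_mean f + cube_mean g.
Proof. by rewrite /cube_mean big_split mulrDl. Qed.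

Lemma meanZ (c : R) f : cube_mean (fun x => c * f x) = c * cube_mean f.
Proof. by rewrite /cube_mean -mulr_sumr mulrA. Qed.

Lemma mean_sum (I : finType) (P : pred I) (F : I -> cube n -> R) :
  cube_mean (fun x => \sum_(k | P k) F k x) = \sum_(k | P k) cube_mean (F k).
Proof. by rewrite /cube_mean exchange_big /= mulr_suml. Qed.

Lemma mean_cst (c : R) : cube_mean (fun _ : cube n => c) = c.
Proof.
by rewrite /cube_mean sumr_const -[c *+ _]mulr_natr mulfK // gt_eqF // card_cube_gt0.
Qed.

Lemma le_mean f g : (forall x, f x <= g x) -> cube_mean f <= cube_mean g.
Proof.
by move=> lefg; rewrite ler_pM2r ?invr_gt0 ?card_cube_gt0 // ler_sum.
Qed.

Lemma mean_ge0 f : (forall x, 0 <= f x) -> 0 <= cube_mean f.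
Proof. by move=> f0; rewrite -[0]mean_cst le_mean. Qed.

Lemma norm_mean f : `|cube_mean f| <= cube_mean (fun x => `|f x|).
Proof.
rewrite normrM [`|_^-1|]ger0_norm ?invr_ge0 ?ler0n //.
by rewrite ler_pM2r ?invr_gt0 ?card_cube_gt0 // ler_norm_sum.
Qed.

Lemma flipK (i : 'I_n) : involutive (flip i).
Proof.
by move=> x; apply/ffunP=> j; rewrite !ffunE; case: eqP => // _; rewrite negbK.
Qed.

Lemma mean_flip i f : cube_mean (fun x => f (flip i x)) = cube_mean f.
Proof.
by rewrite /cube_mean [in RHS](reindex_inj (inv_inj (flipK i))).
Qed.

Lemma mean_odd i f : (forall x, f (flip i x) = - f x) -> cube_mean f = 0.
Proof.
move=> fN; have : cube_mean f = - cube_mean f.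
  rewrite -[LHS](mean_flip i) (eq_mean _ _ fN) -mulN1r -meanZ.
  by apply: eq_mean => x; rewrite mulN1r.
by lra.
Qed.

(** Discriminant argument for the nonnegative quadratic form
    [(a, b) |-> cube_mean ((a f + b g)^2)]. *)
Lemma mean_cauchy_schwarz f g :
  cube_mean (fun x => f x * g x) ^+ 2 <=
  cube_mean (fun x => f x ^+ 2) * cube_mean (fun x => g x ^+ 2).
Proof.
set A := cube_mean (fun x => f x ^+ 2); set B := cube_mean _.
set C := cube_mean (fun x => g x ^+ 2).
have quad a b : 0 <= a ^+ 2 * A + 2 * a * b * B + b ^+ 2 * C.
  rewrite -!meanZ -!meanD; apply: mean_ge0 => x.
  by rewrite (_ : _ + _ = (a * f x + b * g x) ^+ 2) ?sqr_ge0 //; ring.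
have A0 : 0 <= A by apply: mean_ge0 => x; rewrite sqr_ge0.
have : 0 <= C by apply: mean_ge0 => x; rewrite sqr_ge0.
rewrite le_eqVlt => /predU1P[C0|C0].
  (* For C = 0 the form is linear in b; this choice of (a, b) gives it the
     value - B^2 (A + 2), so that B = 0. *)
  have := quad B (- (A + 1)); have := mulr_ge0 (sqr_ge0 B) A0.
  rewrite -C0 mulr0 => D0.
  rewrite (_ : _ + _ = - (B ^+ 2 * A) - 2 * B ^+ 2); last by ring.
  by lra.
have := quad C (- B); rewrite (_ : _ + _ = C * (A * C - B ^+ 2)); last by ring.
by rewrite pmulr_rge0 // subr_ge0.
Qed.

Lemma mean_norm_sqr_le f :
  cube_mean (fun x => `|f x|) ^+ 2 <= cube_mean (fun x => f x ^+ 2).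
Proof.
have := mean_cauchy_schwarz (fun x => `|f x|) (fun=> 1).
rewrite expr1n mean_cst mulr1.
rewrite (eq_mean _ (fun x => `|f x|)); last by move=> x; rewrite mulr1.
by rewrite [X in _ <= X](eq_mean _ (fun x => f x ^+ 2)) // => x;
  rewrite real_normK ?num_real.
Qed.

End Mean.

(** * Two numerical estimates *)

Lemma sqr_succ_le_exp3 (R : realType) m : (m.+1%:R ^+ 2 : R) <= 2 * 3 ^+ m.
Proof.
(* Two consecutive values are carried along, because the step
   (m + 2)^2 <= 3 (m + 1)^2 fails at m = 0. *)
suff /(_ m)[//] : forall k, (k.+1%:R ^+ 2 : R) <= 2 * 3 ^+ k /\
    (k.+2%:R ^+ 2 : R) <= 2 * 3 ^+ k.+1.
elim=> [|k [IH1 IH2]]; first by rewrite expr0 expr1; split; lra.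
split=> //; rewrite [3 ^+ k.+2]exprS.
have k0 : (0 : R) <= k%:R by [].
move: IH2; rewrite -[k.+3%:R]natr1 -[k.+2%:R]natr1 -[k.+1%:R]natr1.
set z := k%:R in k0 *; set e := 3 ^+ _; nra.
Qed.

(** Cutting the spectrum at this level [m], which is of order [ln r], makes
    [3 ^+ m / r] at most [3 ^- m], hence at most of order [(1 + ln r) ^- 2]. *)
Lemma log_scale (R : realType) (r : R) : 1 <= r ->
  exists m : nat, 9 ^+ m <= r /\ 1 + ln r <= 9 * m.+1%:R.
Proof.
move=> r1; exists (trunc_log 9 (Num.truncn r)).
set m := trunc_log _ _.
have /andP[lo hi] := truncn_itv (le_trans ler01 r1).
have k0 : (0 < Num.truncn r)%N by rewrite truncn_gt0.
split.
  by apply: le_trans lo; rewrite -natrX ler_nat trunc_logP.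
have r9 : r <= 9 ^+ m.+1.
  apply: le_trans (ltW hi) _; rewrite -natrX ler_nat.
  exact: trunc_log_ltn.
have ln9 : ln 9 <= 8 :> R.
  by rewrite (_ : 9 = 1 + 8) ?le_ln1Dx //; lra.
have : ln r <= ln 9 *+ m.+1.
  by rewrite -lnXn // ler_ln // posrE ?exprn_gt0 // (lt_le_trans ltr01).
have : ln 9 *+ m.+1 <= 8 * m.+1%:R :> R by rewrite -[ln 9 *+ _]mulr_natr ler_wpM2r.
have : (1 : R) <= m.+1%:R by rewrite ler1n.
lra.
Qed.

(** * Fourier analysis and hypercontractivity *)

Section Fourier.
Context {R : realType} {n : nat}.
Implicit Types (f g : cube n -> R) (S T : {set 'I_n}).

Definition chi S (x : cube n) : R := \prod_(i in S) (-1) ^+ (x i).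

Definition fourier f S : R := cube_mean (fun x => f x * chi S x).

Lemma chi0 x : chi set0 x = 1.
Proof. by rewrite /chi big_set0. Qed.

Lemma chi_norm S x : `|chi S x| = 1.
Proof. by rewrite normr_prod big1 // => i _; rewrite normr_sign. Qed.

Lemma chi_setU1 i S x : i \notin S -> chi (i |: S) x = (-1) ^+ (x i) * chi S x.
Proof. by move=> iS; rewrite /chi big_setU1. Qed.

Lemma chi_flip i S x : chi S (flip i x) = (-1) ^+ (i \in S) * chi S x.
Proof.
have out T : i \notin T -> chi T (flip i x) = chi T x.
  move=> iT; apply: eq_bigr => j jT; rewrite ffunE; case: eqP jT iT => // ->.
  by move=> ->.
case: (boolP (i \in S)) => iS; last by rewrite out // mul1r.
rewrite -(setD1K iS) !chi_setU1 ?in_setD1 ?eqxx // out ?in_setD1 ?eqxx //.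
by rewrite ffunE eqxx signrN mulN1r mulNr.
Qed.

(** Expanding the product over the coordinates of [1 + (-1)^(x i) (-1)^(y i)]
    produces the sum, and a coordinate on which [x] and [y] differ contributes
    a zero factor. *)
Lemma sum_chi x y : \sum_S chi S x * chi S y = #|cube n|%:R *+ (x == y).
Proof.
transitivity (\prod_(i < n) (1 + (-1) ^+ (x i) * (-1) ^+ (y i)) : R).
  under [RHS]eq_bigr do rewrite addrC.
  rewrite bigA_distr /=; apply: eq_big => // S _.
  rewrite /chi -big_split /= big_mkcond /=.
  by [].
case: eqP => [->|/eqP nxy].
  rewrite (eq_bigr (fun=> 2)); last by move=> i _; rewrite -expr2 sqrr_sign.
  by rewrite prodr_const card_ord card_ffun card_bool card_ord natrX.
have [i xyi] : exists i, x i != y i.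
  apply/existsP; apply: contraNT nxy => /existsPn xy.
  by apply/eqP/ffunP => i; apply/eqP; have := xy i; rewrite negbK.
rewrite (bigD1 i) //=; move: xyi; case: (x i); case: (y i) => //= _;
  by rewrite ?expr0 ?expr1 ?mulr1 ?mul1r subrr mul0r.
Qed.

Lemma fourier_inversion f x : f x = \sum_S fourier f S * chi S x.
Proof.
rewrite /fourier /cube_mean.
under eq_bigr do rewrite mulrAC mulr_suml.
rewrite -mulr_suml exchange_big /=.
under eq_bigr do (under eq_bigr do rewrite -mulrA; rewrite -mulr_sumr sum_chi).
rewrite (bigD1 x) //= eqxx mulr1n big1 ?addr0; last first.
  by move=> y /negPf ->; rewrite mulr0n mulr0.
by rewrite mulfK // gt_eqF // card_cube_gt0.
Qed.

Lemma parseval f : cube_mean (fun x => f x ^+ 2) = \sum_S fourier f S ^+ 2.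
Proof.
rewrite (eq_mean _ (fun x => \sum_S fourier f S * (f x * chi S x))); last first.
  move=> x; rewrite expr2 {2}[f x]fourier_inversion mulr_sumr.
  by apply: eq_bigr => S _; rewrite mulrCA.
by rewrite mean_sum; apply: eq_bigr => S _; rewrite meanZ expr2.
Qed.

(** [chi S] is odd in coordinate [i] if [i \in S], and even otherwise. *)
Lemma fourier_deriv i f S :
  fourier (discr_deriv i f) S = if i \in S then - 2 * fourier f S else 0.
Proof.
have -> : fourier (discr_deriv i f) S = ((-1) ^+ (i \in S) - 1) * fourier f S.
  rewrite /fourier (eq_mean _ (fun x => (-1) ^+ (i \in S) *
      (f (flip i x) * chi S (flip i x)) + (- 1) * (f x * chi S x))); last first.
    by move=> x; rewrite chi_flip /discr_deriv mulrCA signrMK; ring.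
  by rewrite meanD !meanZ (mean_flip i (fun x => f x * chi S x)) -mulrDl.
by case: (i \in S); rewrite ?expr1 ?expr0; ring.
Qed.

Lemma norm_fourier_le f S : `|fourier f S| <= cube_mean (fun x => `|f x|).
Proof.
apply: le_trans (norm_mean _) _; apply: le_mean => x.
by rewrite normrM chi_norm mulr1.
Qed.

Lemma sum_subset_setU1 i T (F : {set 'I_n} -> R) : i \in T ->
  \sum_(S : {set _} | S \subset T) F S =
  \sum_(S : {set _} | S \subset T :\ i) (F S + F (i |: S)).
Proof.
move=> iT; rewrite big_split /= (bigID (fun S : {set _} => i \notin S)) /=.
congr (_ + _).
  by apply: eq_bigl => S; rewrite subsetD1.
rewrite (reindex_onto (fun S : {set _} => i |: S) (fun S => S :\ i)) /=; last first.
  by move=> S /andP[_]; rewrite negbK => iS; rewrite setD1K.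
apply: eq_bigl => S; rewrite subUset sub1set iT subsetD1 setU11 /= andbT.
congr (_ && _); apply/eqP/idP => [<-|iS]; first by rewrite setD11.
by rewrite setU1K.
Qed.

(** Hypercontractivity between L2 and L4, by induction on the coordinates in
    [T]. Writing the function as [u + e v], with [e] the sign of coordinate [i]
    and [u], [v] independent of that coordinate, the terms odd in [e] average
    to zero and the fourth moment is that of [u^4 + 6 u^2 v^2 + v^4]. By
    Cauchy-Schwarz and induction it is at most
    [A^2 + 6AB + B^2 <= (A + 3B)^2]: this is where the base 3 comes from. *)
Lemma bonami T (a : {set 'I_n} -> R) :
  cube_mean (fun x => (\sum_(S : {set _} | S \subset T) a S * chi S x) ^+ 4) <=
  (\sum_(S : {set _} | S \subset T) 3 ^+ #|S| * a S ^+ 2) ^+ 2.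
Proof.
elim: {T}#|T| {-2}T (erefl #|T|) a => [|k IH] T cardT a.
  have sub0 S : (S \subset T) = (S == set0).
    by move/eqP: cardT; rewrite cards_eq0 => /eqP ->; rewrite subset0.
  under eq_mean do rewrite (eq_bigl _ _ sub0) big_pred1_eq chi0 mulr1.
  by rewrite mean_cst (eq_bigl _ _ sub0) big_pred1_eq cards0 mul1r -exprM.
have /card_gt0P[i iT] : (0 < #|T|)%N by rewrite cardT.
have cardTi : #|T :\ i| = k by move: cardT; rewrite (cardsD1 i) iT => -[].
have notin S : S \subset T :\ i -> i \notin S by rewrite subsetD1 => /andP[].
pose u x := \sum_(S : {set _} | S \subset T :\ i) a S * chi S x.
pose v x := \sum_(S : {set _} | S \subset T :\ i) a (i |: S) * chi S x.
pose A := \sum_(S : {set _} | S \subset T :\ i) 3 ^+ #|S| * a S ^+ 2.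
pose B := \sum_(S : {set _} | S \subset T :\ i) 3 ^+ #|S| * a (i |: S) ^+ 2.
have uA : cube_mean (fun x => u x ^+ 4) <= A ^+ 2 by apply: IH.
have vB : cube_mean (fun x => v x ^+ 4) <= B ^+ 2
  by apply: (IH _ _ (fun S => a (i |: S))).
have uflip x : u (flip i x) = u x.
  by apply: eq_bigr => S /notin /negPf iS; rewrite chi_flip iS mul1r.
have vflip x : v (flip i x) = v x.
  by apply: eq_bigr => S /notin /negPf iS; rewrite chi_flip iS mul1r.
have splitf x : \sum_(S : {set _} | S \subset T) a S * chi S x =
    u x + (-1) ^+ (x i) * v x.
  rewrite (sum_subset_setU1 i) // big_split /=; congr (_ + _).
  rewrite mulr_sumr; apply: eq_bigr => S /notin iS.
  by rewrite chi_setU1 // mulrCA.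
have splitw : \sum_(S : {set _} | S \subset T) 3 ^+ #|S| * a S ^+ 2 = A + 3 * B.
  rewrite (sum_subset_setU1 i) // big_split /=; congr (_ + _).
  rewrite mulr_sumr; apply: eq_bigr => S /notin iS.
  by rewrite cardsU1 iS add1n exprS -mulrA.
have A0 : 0 <= A by apply: sumr_ge0 => S _; rewrite mulr_ge0 ?sqr_ge0 ?exprn_ge0.
have B0 : 0 <= B by apply: sumr_ge0 => S _; rewrite mulr_ge0 ?sqr_ge0 ?exprn_ge0.
have uv : cube_mean (fun x => u x ^+ 2 * v x ^+ 2) <= A * B.
  rewrite -(@ler_pXn2r _ 2) ?nnegrE; [|by []| |exact: mulr_ge0]; last first.
    by apply: mean_ge0 => x; rewrite mulr_ge0 ?sqr_ge0.
  apply: le_trans (mean_cauchy_schwarz _ _) _.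
  under eq_mean do rewrite -exprM.
  under [X in _ * X <= _]eq_mean do rewrite -exprM.
  by rewrite exprMn ler_pM // mean_ge0 // => x; rewrite (exprM _ 2 2) sqr_ge0.
rewrite splitw.
rewrite (eq_mean _ (fun x => u x ^+ 4 + 6 * (u x ^+ 2 * v x ^+ 2) + v x ^+ 4 +
   4 * ((-1) ^+ (x i) * (u x ^+ 3 * v x + u x * v x ^+ 3)))); last first.
  by move=> x; rewrite splitf; case: (x i); rewrite ?expr0 ?expr1; ring.
rewrite !meanD !meanZ (mean_odd i (fun x => (-1) ^+ (x i) * _)); last first.
  by move=> x; rewrite uflip vflip ffunE eqxx signrN mulNr.
nra.
Qed.

(** With [h] the part of [g] of level at most [m], the mass [W] is the mean of
    [h g]. Two applications of Cauchy-Schwarz, pairing first [h |g|^(1/2)] with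
    [|g|^(1/2)] and then [h^2] with [|g|], bound [W^4] by
    [E h^4 (E g^2) (E |g|)^2], and [bonami] bounds [E h^4] by [9^m W^2]. *)
Lemma low_degree_mass g m :
  \sum_(S : {set _} | (#|S| <= m)%N) fourier g S ^+ 2 <=
  3 ^+ m * (Num.sqrt (cube_mean (fun x => g x ^+ 2)) * cube_mean (fun x => `|g x|)).
Proof.
pose a (S : {set _}) := if (#|S| <= m)%N then fourier g S else 0.
pose h x := \sum_(S : {set _} | S \subset setT) a S * chi S x.
set W := \sum_(_ | _) _; set G2 := cube_mean _; set G1 := cube_mean _.
have W0 : 0 <= W by apply: sumr_ge0 => S _; rewrite sqr_ge0.
have G20 : 0 <= G2 by apply: mean_ge0 => x; rewrite sqr_ge0.
have G10 : 0 <= G1 by apply: mean_ge0.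
have hW : cube_mean (fun x => h x * g x) = W.
  under eq_mean do rewrite mulr_suml.
  rewrite mean_sum /W [RHS]big_mkcond /=.
  apply: eq_big => S; first by rewrite subsetT.
  move=> _; under eq_mean do rewrite -mulrA [chi _ _ * _]mulrC.
  by rewrite meanZ /a; case: ifP => _; rewrite ?mul0r // expr2.
have h4 : cube_mean (fun x => h x ^+ 4) <= (3 ^+ m * W) ^+ 2.
  apply: le_trans (bonami _ _) _.
  rewrite ler_pXn2r ?nnegrE ?mulr_ge0 ?exprn_ge0 //; last first.
    by apply: sumr_ge0 => S _; rewrite mulr_ge0 ?sqr_ge0 ?exprn_ge0.
  rewrite /W big_mkcond [X in _ <= _ * X]big_mkcond mulr_sumr /=.
  apply: ler_sum => S _.
  rewrite subsetT /a; case: ifP => Sm; last by rewrite expr0n !mulr0.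
  by rewrite ler_wpM2r ?sqr_ge0 // ler_weXn2l // ler1n.
pose H := cube_mean (fun x => h x ^+ 2 * `|g x|).
have H0 : 0 <= H by apply: mean_ge0 => x; rewrite mulr_ge0 ?sqr_ge0.
have WH : W ^+ 2 <= H * G1.
  have := mean_cauchy_schwarz (fun x => h x * Num.sqrt `|g x|)
    (fun x => Num.sg (g x) * Num.sqrt `|g x|).
  congr (_ ^+ 2 <= _ * _).
  - rewrite -hW; apply: eq_mean => x.
    by rewrite mulrACA -expr2 sqr_sqrtr // -mulrA -numEsg.
  - by apply: eq_mean => x; rewrite exprMn sqr_sqrtr.
  - apply: eq_mean => x; rewrite exprMn sqr_sqrtr // sqr_sg.
    by case: eqP => [->|_]; rewrite ?normr0 ?mul0r ?mul1r.
have HG : H ^+ 2 <= (3 ^+ m * W) ^+ 2 * G2.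
  apply: le_trans (mean_cauchy_schwarz _ _) _.
  under eq_mean do rewrite -exprM.
  under [X in _ * X <= _]eq_mean do rewrite real_normK ?num_real //.
  by rewrite ler_wpM2r.
have HG' : H <= 3 ^+ m * W * Num.sqrt G2.
  rewrite -(@ler_pXn2r _ 2) ?nnegrE //; last first.
    by rewrite !mulr_ge0 ?exprn_ge0 ?sqrtr_ge0.
  by rewrite [leRHS]exprMn sqr_sqrtr.
move: W0; rewrite le_eqVlt => /predU1P[<-|W0].
  by apply: mulr_ge0; [exact: exprn_ge0 | apply: mulr_ge0 => //; exact: sqrtr_ge0].
rewrite -(ler_pM2l W0) -expr2; apply: le_trans WH _.
apply: le_trans (ler_wpM2r G10 HG') _.
by rewrite le_eqVlt; apply/orP; left; apply/eqP; ring.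
Qed.

(** The weight [(#|S| + 1)^-2] turns concentration of [g] on a small set, seen as
    a large ratio [|g|_2 / |g|_1], into a logarithmic gain: such a [g] has little
    mass on the low levels. *)
Lemma talagrand_spectral g :
  \sum_(S : {set 'I_n}) fourier g S ^+ 2 / (#|S|.+1)%:R ^+ 2 <=
  243 * (cube_mean (fun x => g x ^+ 2) /
    (1 + ln (Num.sqrt (cube_mean (fun x => g x ^+ 2)) /
             cube_mean (fun x => `|g x|))) ^+ 2).
Proof.
set G2 := cube_mean (fun x => g x ^+ 2); set G1 := cube_mean _.
have G20 : 0 <= G2 by apply: mean_ge0 => x; rewrite sqr_ge0.
have G10 : 0 <= G1 by apply: mean_ge0.
have G12 : G1 ^+ 2 <= G2 by exact: mean_norm_sqr_le.
(* If g = 0 the ratio of the norms is meaningless, but every coefficient of g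
   vanishes. *)
have [G1eq|G1n0] := eqVneq G1 0.
  rewrite big1.
    by apply: mulr_ge0 => //; apply: divr_ge0 => //; exact: sqr_ge0.
  move=> S _; have := norm_fourier_le g S; rewrite -/G1 G1eq normr_le0 => /eqP ->.
  by rewrite expr0n mul0r.
have G1p : 0 < G1 by rewrite lt_neqAle eq_sym G1n0.
pose s := Num.sqrt G2; have sG : s ^+ 2 = G2 by rewrite sqr_sqrtr.
have G1s : G1 <= s by rewrite -(@ler_pXn2r _ 2) ?nnegrE ?sqrtr_ge0 // sG.
have r1 : 1 <= s / G1 by rewrite ler_pdivlMr // mul1r.
have [m [mlo mhi]] := log_scale _ _ r1; rewrite -/s.
set L := 1 + ln _ in mhi *.
have L1 : 1 <= L by rewrite lerDl ln_ge0.
(* Here 3^m |g|_2 |g|_1 <= 3^-m |g|_2^2 because 9^m |g|_1 <= |g|_2. *)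
have low : \sum_(S : {set 'I_n} | (#|S| <= m)%N) fourier g S ^+ 2 / (#|S|.+1)%:R ^+ 2
    <= 2 * (G2 / m.+1%:R ^+ 2).
  have /le_trans : \sum_(S : {set 'I_n} | (#|S| <= m)%N)
      fourier g S ^+ 2 / (#|S|.+1)%:R ^+ 2 <= \sum_(S : {set 'I_n} | (#|S| <= m)%N) fourier g S ^+ 2.
    apply: ler_sum => S _; rewrite ler_pdivrMr ?exprn_gt0 //.
    by rewrite ler_peMr ?sqr_ge0 // exprn_ege1 // ler1n.
  apply; apply: le_trans (low_degree_mass g m) _; rewrite -/G2 -/G1 -/s.
  rewrite [leRHS]mulrA ler_pdivlMr ?exprn_gt0 //.
  apply: le_trans (ler_wpM2l _ (sqr_succ_le_exp3 R m)) _.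
    by apply: mulr_ge0; [exact: exprn_ge0 | apply: mulr_ge0 => //; exact: sqrtr_ge0].
  move: mlo; rewrite ler_pdivlMr // => mlo.
  have -> : 3 ^+ m * (s * G1) * (2 * 3 ^+ m) = 2 * (s * (9 ^+ m * G1)).
    by rewrite (_ : 9 = 3 * 3) ?exprMn; [ring|lra].
  by rewrite ler_pM2l // -sG expr2 ler_wpM2l ?sqrtr_ge0.
have high : \sum_(S : {set 'I_n} | ~~ (#|S| <= m)%N)
    fourier g S ^+ 2 / (#|S|.+1)%:R ^+ 2
    <= G2 / m.+1%:R ^+ 2.
  rewrite /G2 parseval mulr_suml big_mkcond /=; apply: ler_sum => S _.
  case: ifPn => [|_]; last by rewrite divr_ge0 ?sqr_ge0.
  rewrite -ltnNge => mS; rewrite ler_wpM2l ?sqr_ge0 // lef_pV2 ?posrE ?exprn_gt0 //.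
  by rewrite ler_pXn2r ?nnegrE // ler_nat ltnS ltnW.
rewrite (bigID (fun S : {set _} => (#|S| <= m)%N)) /=.
apply: le_trans (lerD low high) _.
have mp : 0 < m.+1%:R ^+ 2 :> R by rewrite exprn_gt0.
have Lp : 0 < L ^+ 2 by rewrite exprn_gt0 // (lt_le_trans ltr01).
have Lm : L ^+ 2 <= 81 * m.+1%:R ^+ 2.
  rewrite (_ : 81 * _ = (9 * m.+1%:R) ^+ 2); last by ring.
  by rewrite ler_pXn2r ?nnegrE ?mulr_ge0 // (le_trans ler01).
have : (m.+1%:R ^+ 2)^-1 <= 81 / L ^+ 2.
  by rewrite ler_pdivlMr // ler_pdivrMl // mulrC.
move/(ler_wpM2l G20); rewrite [leRHS]mulrCA.
by set u := G2 / _; set v := G2 / _; lra.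
Qed.

End Fourier.

(** * The variance and second derivatives *)

Section Order2.
Context {R : realType} {n : nat}.
Implicit Types (f g : cube n -> R).

Lemma var_fourier f :
  cube_var f = \sum_(S : {set 'I_n} | S != set0) fourier f S ^+ 2.
Proof.
rewrite /cube_var parseval (bigD1 set0) //= addrC.
rewrite (_ : fourier f set0 = cube_mean f) ?addrK //.
by apply: eq_mean => x; rewrite chi0 mulr1.
Qed.

Lemma fourier_deriv2 i j f S :
  fourier (discr_deriv2 i j f) S =
  if (i \in S) && (j \in S) then 4 * fourier f S else 0.
Proof.
rewrite !fourier_deriv; case: (i \in S); case: (j \in S) => //=; rewrite ?mulr0 //.
by rewrite mulrA; congr (_ * _); ring.
Qed.

Lemma sum_level1 f :
  \sum_(S : {set 'I_n} | #|S| == 1%N) fourier f S ^+ 2 =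
  \sum_(i < n) fourier f [set i] ^+ 2.
Proof.
transitivity (\sum_(S in set1 @: 'I_n) fourier f S ^+ 2).
  by apply: eq_bigl => S; apply/cards1P/imsetP => [[i ->]|[i _ ->]]; exists i.
by rewrite big_imset //= => i j _ _; exact: set1_inj.
Qed.

Lemma level1_le f i :
  fourier f [set i] ^+ 2 <= cube_mean (fun x => `|discr_deriv i f x|) ^+ 2.
Proof.
have := norm_fourier_le (discr_deriv i f) [set i].
rewrite fourier_deriv set11 normrM normrN (ger0_norm (ler0n R 2)) => le2.
rewrite -(real_normK (num_real (fourier f [set i]))).
rewrite ler_pXn2r ?nnegrE ?normr_ge0 //; last by apply: mean_ge0.
by have := normr_ge0 (fourier f [set i]); lra.
Qed.

Lemma sum_pairs (S : {set 'I_n}) (c : R) :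
  \sum_(i < n) \sum_(j < n | i != j) (if (i \in S) && (j \in S) then c else 0) =
  c * (#|S| * #|S|.-1)%:R.
Proof.
transitivity (\sum_(i in S) c * #|S|.-1%:R).
  rewrite [RHS]big_mkcond /=; apply: eq_bigr => i _.
  case: ifP => iS; last by rewrite big1.
  rewrite -big_mkcondr /= (eq_bigl (mem (S :\ i))).
    by rewrite sumr_const (cardsD1 i S) iS -[c *+ _]mulr_natr.
  by move=> j; rewrite !inE eq_sym.
by rewrite sumr_const -[_ *+ #|S|]mulr_natr -mulrA -natrM mulnC.
Qed.

(** Exchanging the sums, a set of size k receives 16k(k-1)/(k+1)^2 times its own
    squared coefficient, and this factor is at least 1 when k >= 2. *)
Lemma high_levels_le f :
  \sum_(S : {set 'I_n} | (1 < #|S|)%N) fourier f S ^+ 2 <=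
  \sum_(i < n) \sum_(j < n | i != j)
    \sum_(S : {set 'I_n}) fourier (discr_deriv2 i j f) S ^+ 2 / (#|S|.+1)%:R ^+ 2.
Proof.
under [leRHS]eq_bigr do rewrite exchange_big /=.
rewrite exchange_big /= big_mkcond; apply: ler_sum => S _.
under eq_bigr do under eq_bigr do rewrite fourier_deriv2.
set c := 16 * fourier f S ^+ 2 / #|S|.+1%:R ^+ 2.
have c0 : 0 <= c.
  apply: divr_ge0; last exact: sqr_ge0.
  apply: mulr_ge0; last exact: sqr_ge0.
  by rewrite ler0n.
rewrite (_ : \sum_i _ = c * (#|S| * #|S|.-1)%:R); last first.
  rewrite -sum_pairs; apply: eq_bigr => i _; apply: eq_bigr => j _.
  case: ifP => _; last by rewrite expr0n mul0r.
  by rewrite exprMn /c; congr (_ * _ / _); ring.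
case: ifP => [S2|_]; last by rewrite mulr_ge0.
rewrite /c [leRHS]mulrAC ler_pdivlMr ?exprn_gt0 // [16 * _]mulrC -[leRHS]mulrA.
rewrite ler_wpM2l ?sqr_ge0 //.
move: S2; case: #|S| => [|[|k]] //= _.
rewrite natrM -[k.+3%:R]natr1 -[k.+2%:R]natr1 -[k.+1%:R]natr1.
have := ler0n R k; set z := k%:R; nra.
Qed.

(** The second-order inequality for arbitrary real-valued functions. *)
Lemma var_le_order2 f :
  cube_var f <=
    243 * (\sum_(i < n) cube_mean (fun x => `|discr_deriv i f x|) ^+ 2 +
      \sum_(i < n) \sum_(j < n | i != j)
        cube_mean (fun x => discr_deriv2 i j f x ^+ 2) /
        (1 + ln (Num.sqrt (cube_mean (fun x => discr_deriv2 i j f x ^+ 2)) /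
                 cube_mean (fun x => `|discr_deriv2 i j f x|))) ^+ 2).
Proof.
rewrite var_fourier (bigID (fun S : {set _} => #|S| == 1%N)) /= mulrDr; apply: lerD.
  rewrite (eq_bigl (fun S : {set _} => #|S| == 1%N)); last first.
    by move=> S; rewrite -cards_eq0; case: #|S| => [|[|]].
  rewrite sum_level1 mulr_sumr; apply: ler_sum => i _.
  apply: le_trans (level1_le f i) _.
  by have := sqr_ge0 (cube_mean (fun x => `|discr_deriv i f x|)); lra.
rewrite (eq_bigl (fun S : {set _} => (1 < #|S|)%N)); last first.
  by move=> S; rewrite -cards_eq0; case: #|S| => [|[|]].
apply: le_trans (high_levels_le f) _; rewrite mulr_sumr; apply: ler_sum => i _.
rewrite mulr_sumr; apply: ler_sum => j _; exact: talagrand_spectral.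
Qed.

Lemma lpnorm1E f : lpnorm 1 f = cube_mean (fun x => `|f x|).
Proof.
rewrite /lpnorm invr1 powRr1; last by apply: mean_ge0 => x; exact: powR_ge0.
by apply: eq_mean => x; rewrite powRr1.
Qed.

Lemma lpnorm2E f : lpnorm 2 f = Num.sqrt (cube_mean (fun x => f x ^+ 2)).
Proof.
rewrite /lpnorm powR12_sqrt; last by apply: mean_ge0 => x; exact: powR_ge0.
congr Num.sqrt; apply: eq_mean => x.
by rewrite powR_mulrn // real_normK ?num_real.
Qed.

(** For [|f|] with values in {0, 1} and mean [I], the Lp norm is [I `^ p^-1],
    and [I <= 1]. *)
Lemma lpnorm_mono_indicator f p : 1 <= p ->
  (forall x, `|f x| = 0 \/ `|f x| = 1) -> lpnorm 1 f <= lpnorm p f.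
Proof.
move=> p1 f01; rewrite lpnorm1E.
have p0 : 0 < p by rewrite (lt_le_trans ltr01).
rewrite /lpnorm (eq_mean _ (fun x => `|f x|)); last first.
  by move=> x; case: (f01 x) => ->; rewrite ?powR1 ?powR0 // gt_eqF.
set I := cube_mean _.
have : 0 <= I by apply: mean_ge0.
rewrite le_eqVlt => /predU1P[<-|I0]; first exact: powR_ge0.
apply: ger1_powR; last by rewrite invf_le1.
rewrite I0 /= -[leRHS](@mean_cst R n); apply: le_mean => x.
by case: (f01 x) => ->.
Qed.

End Order2.

Theorem theorem4 (R : realType) :
  exists2 C : R, 0 < C &
    forall s0 : R, 0 < s0 -> s0 < 1 / 128 ->
    forall (n : nat) (f : cube n -> R),
      (1 <= n)%N -> (forall x : cube n, f x = 0 \/ f x = 1) ->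
      cube_var f <=
        C * (\sum_(i < n) lpnorm (1 + expR (- 2 * s0)) (discr_deriv i f) ^+ 2 +
             \sum_(i < n) \sum_(j < n | i != j)
               lpnorm 2 (discr_deriv2 i j f) ^+ 2 /
               (1 + ln (lpnorm 2 (discr_deriv2 i j f) / lpnorm 1 (discr_deriv2 i j f))) ^+ 2).
Proof.
exists 243 => // s0 _ _ n f _ f01.
apply: le_trans (var_le_order2 f) _; rewrite ler_pM2l //; apply: lerD.
  apply: ler_sum => i _; rewrite -lpnorm1E.
  rewrite ler_pXn2r ?nnegrE ?powR_ge0 //; apply: lpnorm_mono_indicator.
    by rewrite lerDl expR_ge0.
  move=> x; rewrite /discr_deriv.
  case: (f01 x) => ->; case: (f01 (flip i x)) => ->;
    rewrite ?subrr ?subr0 ?sub0r ?normrN ?normr0 ?normr1; by [left | right].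
apply: ler_sum => i _; apply: ler_sum => j _.
rewrite lpnorm1E lpnorm2E sqr_sqrtr //.
by apply: mean_ge0 => x; exact: sqr_ge0.
Qed.
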